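(* Let $n\ge 1$. For $w\in S_{2n+1}$ and a reduced word $\mathbf{i}=i_1\cdots i_\ell$ of $w$, consider the map $\psi_{\mathbf{i}}:\mathbb{R}_{>0}^\ell\to (EL_{2n})_{\ge0}$, $\psi_{\mathbf{i}}(a_1,\dots,a_\ell)=u_{i_1}(a_1)\cdots u_{i_\ell}(a_\ell)$, and let $E(w)$ be its image (which depends only on $w$). Then the sets $E(w)$, $w\in S_{2n+1}$, are pairwise disjoint and their union is $(EL_{2n})_{\geq 0}$. Moreover, for every $w$ and every reduced word $\mathbf{i}$ of $w$, the map $\psi_{\mathbf{i}}:\mathbb{R}_{>0}^\ell\to E(w)$ is a homeomorphism.
   Context: The electrical Lie algebra $\mathfrak{el}_{2n}$ is the real Lie algebra generated by $e_1,\dots,e_{2n}$ with relations $[e_i,e_j]=0$ for $|i-j|>1$ and $[e_i,[e_i,e_j]]=-2e_i$ for $|i-j|=1$. It is isomorphic to $\mathfrak{sp}_{2n}(\mathbb{R})$ (real $2n\times 2n$ block matrices $\begin{pmatrix} A&B\\ C&D\end{pmatrix}$ with $A=-D^T$, $B=B^T$, $C=C^T$) via $$e_{2i-1}\mapsto\begin{pmatrix}0&a_ia_i^T\\0&0\end{pmatrix},\qquad e_{2i}\mapsto\begin{pmatrix}0&0\\ b_ib_i^T&0\end{pmatrix}\qquad(1\le i\le n),$$ where $\varepsilon_1,\dots,\varepsilon_n$ is the standard basis of $\mathbb{R}^n$ (column vectors), $a_1=\varepsilon_1$, $a_i=\varepsilon_{i-1}+\varepsilon_i$ for $2\le i\le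 n$, and $b_i=\varepsilon_i$. The electrical Lie group $EL_{2n}$ is the real symplectic group $Sp_{2n}(\mathbb{R})$ with Lie algebra identified with $\mathfrak{el}_{2n}$ in this way, and $u_i(a)=\exp(ae_i)$. The nonnegative part $(EL_{2n})_{\ge0}$ is the subsemigroup of $EL_{2n}$ generated by all $u_i(a)$ with $1\le i\le 2n$ and $a\ge0$. A reduced word of $w\in S_{2n+1}$ is a sequence $i_1\cdots i_\ell$ of minimal length with $w=s_{i_1}\cdots s_{i_\ell}$, where $s_i=(i\ i+1)$, $1\le i\le 2n$; for $w$ the identity the word is empty and $E(w)=\{1\}$. $E(w)$ carries the subspace topology from $EL_{2n}$. *)

(* Defs.v *)
From HB Require Import structures.
From mathcomp Require Import all_boot all_order all_fingroup all_algebra.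
From mathcomp Require Import all_classical all_reals all_analysis.

Set Implicit Arguments.
Unset Strict Implicit.
Unset Printing Implicit Defensive.

Import Order.TTheory GRing.Theory Num.Theory.
Import numFieldNormedType.Exports.

Local Open Scope classical_set_scope.
Local Open Scope ring_scope.

(* [{within _, continuous _}] is continuity for the subspace topology, and
   [g] below is, on [B], the inverse of [f : A -> B]. *)
Definition homeomorphism_on (T U : topologicalType) (A : set T) (B : set U)
    (f : T -> U) : Prop :=
  [/\ set_bij A B f,
      {within A, continuous f}
    & exists2 g : U -> T,
        {within B, continuous g} & forall x, A x -> g (f x) = x].

Section ElectricalGroup.
Variables (R : realType) (n : nat).

Definition expmx (m : nat) (A : 'M[R]_m) : 'M[R]_m :=
  limn (series (fun k : nat => (k`!%:R)^-1 *: A ^+ k)).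

(* Indices are shifted to start at 0: [eps k], [avec k], [bvec k] and [elgen i]
   are the vectors $\varepsilon_{k+1}$, $a_{k+1}$, $b_{k+1}$ for k < n and the
   image in $\mathfrak{sp}_{2n}(\mathbb{R})$ of the generator $e_{i+1}$ for
   i < 2n. *)
Definition eps (k : nat) : 'cV[R]_n := \col_(j < n) ((j : nat) == k)%:R.

Definition avec (k : nat) : 'cV[R]_n :=
  if k is k'.+1 then eps k' + eps k else eps 0.

Definition bvec (k : nat) : 'cV[R]_n := eps k.

Definition elgen (i : nat) : 'M[R]_(n + n) :=
  if odd i then block_mx 0 0 (bvec i./2 *m (bvec i./2)^T) 0
  else block_mx 0 (avec i./2 *m (avec i./2)^T) 0 0.

Definition sympJ : 'M[R]_(n + n) := block_mx 0 1%:M (- 1%:M) 0.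

(* The electrical Lie group $EL_{2n} = Sp_{2n}(\mathbb{R})$, as a subset (and
   topological subspace) of the real matrices. *)
Definition EL : set 'M[R]_(n + n) := [set M | M^T *m sympJ *m M = sympJ].

Definition uel (i : 'I_(2 * n)) (a : R) : 'M[R]_(n + n) := expmx (a *: elgen i).

Definition subsemigroup_of_EL (S : set 'M[R]_(n + n)) : Prop :=
  S `<=` EL /\ (forall x y, S x -> S y -> S (x *m y)).

Definition EL_ge0 : set 'M[R]_(n + n) :=
  smallest subsemigroup_of_EL
    [set M | exists i : 'I_(2 * n), exists2 a : R, 0 <= a & M = uel i a].

Definition stransp (i : 'I_(2 * n)) : 'S_(2 * n).+1 :=
  tperm (widen_ord (leqnSn (2 * n)) i) (lift ord0 i).

Definition word_perm (s : seq 'I_(2 * n)) : 'S_(2 * n).+1 :=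
  (\prod_(i <- s) stransp i)%g.

(* Permutations multiply from left to right in the library. The opposite
   convention would replace w by its inverse throughout. *)
Definition reduced_word (w : 'S_(2 * n).+1) (s : seq 'I_(2 * n)) : Prop :=
  word_perm s = w /\
  forall t : seq 'I_(2 * n), word_perm t = w -> (size s <= size t)%N.

Definition pos_orthant (l : nat) : set 'rV[R]_l :=
  [set a | forall k : 'I_l, 0 < a 0 k].

Definition psi (s : seq 'I_(2 * n)) (a : 'rV[R]_(size s)) : 'M[R]_(n + n) :=
  \prod_(k < size s) uel (tnth (in_tuple s) k) (a 0 k).

(* A priori the union of the images over all reduced words of w, so that no
   reduced word has to be chosen. *)
Definition Ecell (w : 'S_(2 * n).+1) : set 'M[R]_(n + n) :=
  \bigcup_(s in reduced_word w) (@psi s @` @pos_orthant (size s)).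

End ElectricalGroup.

Arguments pos_orthant R l : clear implicits.
Arguments psi R {n} s a.
Arguments Ecell R {n} w.
Arguments EL_ge0 R n : clear implicits.

(* Main.v *)
Require Import Defs.
From mathcomp Require Import all_boot all_order all_fingroup all_algebra.
From mathcomp Require Import all_classical all_reals all_analysis.
From mathcomp Require Import zify ring.
Import Order.TTheory GRing.Theory Num.Theory.
Import numFieldNormedType.Exports.

Local Open Scope classical_set_scope.
Local Open Scope ring_scope.

Set Implicit Arguments.
Unset Strict Implicit.

(** Each generator is a rank-one matrix of square zero, the product of a column
    [gen_col i] and a row [gen_row i], and [gen_row i *m gen_col j] is 1 if [i]
    and [j] are neighbours and 0 otherwise. Hence [uel i c] is [1 + c e_i], and
    the one-parameter subgroups satisfy: distant ones commute, equal ones merge,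
    and for neighbours

      u_i(a) u_j(b) u_i(c) = u_j(bc/d) u_i(d) u_j(ab/d),   d = a + c + abc.

    The change of parameters in the last relation is a continuous involution of
    the positive orthant. So a commutation or a braid move changes neither the
    image of a word nor the existence of a continuous inverse of its
    parametrization ([cell_braid_eq], [recovers_braid_eq]).

    Call a word a staircase word if it is a concatenation of descending blocks
    R_0 R_1 R_2 ..., where R_M is M, M-1, ..., k_M and may be empty. A letter
    appended to a staircase word can be slid to the left until it extends a
    block or meets an equal letter ([staircase_insert]). As the permutation
    of a staircase word determines the word ([staircase_perm_inj]), each
    permutation has exactly one staircase word, all its reduced words are
    connected to it by commutations and braid moves, and every product of the
    [uel i c] with positive parameters lies in the image of a staircase word.

    It remains to treat staircase words. Let [col_dual M] be the row vector dual
    to [gen_col M]. It is fixed by all letters below [M], so only the last block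
    acts on it, and the block sends it to itself plus a combination of the
    rows [gen_row M], [gen_row (M - 1)], ... whose coefficients are c_M,
    c_M c_(M-1), ..., the partial products of the parameters of the block
    ([last_coefE]). These rows are linearly independent, so these
    coefficients are affine functions of the product matrix. Which of
    them vanish gives the length of the last block, and their quotients give its
    parameters. Dividing out the block and repeating recovers the whole word,
    which makes the images disjoint ([staircase_cell_inj]), and all its
    parameters as continuous functions ([staircase_recovers]). *)

(** * Words up to commutations and braid moves *)

(** Letters are plain natural numbers, so that shifting a letter by one needs no
    bound; bounds on the letters are separate hypotheses. *)
Inductive braid_eq : seq nat -> seq nat -> Prop :=
| BraidRefl s : braid_eq s s
| BraidTrans s t r : braid_eq s t -> braid_eq t r -> braid_eq s r
| BraidFar i j s1 s2 : (i.+1 < j)%N || (j.+1 < i)%N ->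
    braid_eq (s1 ++ [:: i; j] ++ s2) (s1 ++ [:: j; i] ++ s2)
| BraidNear i j s1 s2 : (j == i.+1) || (i == j.+1) ->
    braid_eq (s1 ++ [:: i; j; i] ++ s2) (s1 ++ [:: j; i; j] ++ s2).

Lemma braid_eq_sym s t : braid_eq s t -> braid_eq t s.
Proof.
elim=> [r|r1 r2 r3 _ H1 _ H2|i j s1 s2 ij|i j s1 s2 ij].
- exact: BraidRefl.
- exact: BraidTrans H2 H1.
- by apply: BraidFar; rewrite orbC.
- by apply: BraidNear; rewrite orbC.
Qed.

Lemma braid_eq_cat p q s t : braid_eq s t -> braid_eq (p ++ s ++ q) (p ++ t ++ q).
Proof.
elim=> [r|r1 r2 r3 _ H1 _ H2|i j s1 s2 ij|i j s1 s2 ij].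
- exact: BraidRefl.
- exact: BraidTrans H1 H2.
- by have := BraidFar (p ++ s1) (s2 ++ q) ij; rewrite -!catA.
- by have := BraidNear (p ++ s1) (s2 ++ q) ij; rewrite -!catA.
Qed.

Lemma braid_eq_catl p s t : braid_eq s t -> braid_eq (p ++ s) (p ++ t).
Proof. by move=> /(braid_eq_cat p [::]); rewrite !cats0. Qed.

Lemma braid_eq_catr q s t : braid_eq s t -> braid_eq (s ++ q) (t ++ q).
Proof. exact: (braid_eq_cat [::] q). Qed.

Lemma braid_eq_size s t : braid_eq s t -> size s = size t.
Proof.
by elim=> // [? ? ? _ -> _ -> //|? ? ? ? _|? ? ? ? _]; rewrite !size_cat.
Qed.

Lemma braid_eq_all (p : pred nat) s t : braid_eq s t -> all p s = all p t.
Proof.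
elim=> // [? ? ? _ -> _ -> //|i j s1 s2 _|i j s1 s2 _]; rewrite !all_cat /=.
  by case: (p i); case: (p j).
by case: (p i); case: (p j).
Qed.

Lemma braid_eq_commute i s :
  all (fun j => (i.+1 < j)%N || (j.+1 < i)%N) s -> braid_eq (s ++ [:: i]) (i :: s).
Proof.
elim: s => [_|j s IH] /=; first exact: BraidRefl.
case/andP=> ij /IH sP; apply: (@BraidTrans _ (j :: i :: s)).
  exact: (braid_eq_catl [:: j] sP).
by apply: (BraidFar [::] s); rewrite orbC.
Qed.

(** * Staircase words *)

Definition descent (k m : nat) : seq nat := rev (iota k m).

Lemma size_descent k m : size (descent k m) = m.
Proof. by rewrite size_rev size_iota. Qed.

Lemma mem_descent k m j : (j \in descent k m) = (k <= j < k + m)%N.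
Proof. by rewrite mem_rev mem_iota. Qed.

Lemma descent_rcons k m : descent k m.+1 = descent k.+1 m ++ [:: k].
Proof. by rewrite /descent /= rev_cons cats1. Qed.

Lemma descent_cons k m : descent k m.+1 = (k + m)%N :: descent k m.
Proof. by rewrite /descent -addn1 iotaD rev_cat. Qed.

Lemma descent_cat k m p : descent k (m + p) = descent (k + m) p ++ descent k m.
Proof. by rewrite /descent iotaD rev_cat. Qed.

(** A descending block commutes past a letter inside it at the price of lowering
    that letter: the letter travels left until it meets its neighbour, where one
    braid move turns it into that neighbour. *)
Lemma descent_slide M k i : (k <= i)%N -> (i < M)%N ->
  braid_eq (descent k (M.+1 - k) ++ [:: i.+1]) (i :: descent k (M.+1 - k)).
Proof.
move=> ki iM.
have -> : descent k (M.+1 - k) =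
    descent i.+2 (M.+1 - i.+2) ++ [:: i.+1; i] ++ descent k (i - k).
  have -> : (M.+1 - k = (i - k) + (2 + (M.+1 - i.+2)))%N by lia.
  rewrite descent_cat subnKC // descent_cat -catA addn2; congr (_ ++ (_ ++ _)).
set hi := descent i.+2 _; set lo := descent k _.
apply: (@BraidTrans _ (hi ++ [:: i.+1; i; i.+1] ++ lo)).
  have lo_far : braid_eq (lo ++ [:: i.+1]) (i.+1 :: lo).
    by apply: braid_eq_commute; apply/allP => j; rewrite mem_descent; lia.
  by have := braid_eq_catl (hi ++ [:: i.+1; i]) lo_far; rewrite -!catA.
apply: (@BraidTrans _ (hi ++ [:: i; i.+1; i] ++ lo)).
  by apply: BraidNear; rewrite eqxx orbT.
have hi_far : braid_eq (hi ++ [:: i]) (i :: hi).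
  by apply: braid_eq_commute; apply/allP => j; rewrite mem_descent; lia.
by have := braid_eq_catr ([:: i.+1; i] ++ lo) hi_far; rewrite -!catA.
Qed.

(** The block added at stage [M.+1] runs down from the new letter [M] to [k]; it
    is empty for [k = M.+1]. *)
Fixpoint staircase (M : nat) (s : seq nat) : Prop :=
  if M is M'.+1 then
    exists t k, [/\ staircase M' t, (k <= M)%N & s = t ++ descent k (M - k)]
  else s = [::].

Lemma staircase_all M s : staircase M s -> all (fun i => (i < M)%N) s.
Proof.
elim: M s => [s -> //|M IH s] [t [k [/IH tM kM ->]]].
rewrite all_cat; apply/andP; split.
  by apply/allP => i /(allP tM); lia.
by apply/allP => i; rewrite mem_descent; lia.
Qed.

(** The letter [i] either extends the last block at its lower end, or repeats
    its lowest letter, or passes to the left of the block, as itself if it lies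
    below and lowered by one if it lies inside, and then meets a shorter
    staircase word. *)
Lemma staircase_insert M s i : staircase M s -> (i < M)%N ->
  (exists2 s', staircase M s' & braid_eq (s ++ [:: i]) s') \/
  (exists s1 j s2, braid_eq (s ++ [:: i]) (s1 ++ [:: j; j] ++ s2) /\
                   braid_eq s (s1 ++ [:: j] ++ s2)).
Proof.
elim: M s i => [//|M IH] s i [t [k [tM kM ->]]] iM.
have enter j : (j < M)%N ->
    braid_eq (descent k (M.+1 - k) ++ [:: i]) (j :: descent k (M.+1 - k)) ->
  (exists2 s', staircase M.+1 s' &
    braid_eq ((t ++ descent k (M.+1 - k)) ++ [:: i]) s') \/
  (exists s1 j s2,
    braid_eq ((t ++ descent k (M.+1 - k)) ++ [:: i]) (s1 ++ [:: j; j] ++ s2) /\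
    braid_eq (t ++ descent k (M.+1 - k)) (s1 ++ [:: j] ++ s2)).
  move=> jM pass.
  have tjE : braid_eq ((t ++ descent k (M.+1 - k)) ++ [:: i])
                      ((t ++ [:: j]) ++ descent k (M.+1 - k)).
    by have := braid_eq_catl t pass; rewrite -!catA.
  case: (IH t j tM jM) => [[t' t'M tt']|[s1 [l [s2 [sE tE]]]]].
    left; exists (t' ++ descent k (M.+1 - k)); first by exists t', k.
    by apply: BraidTrans tjE _; apply: braid_eq_catr.
  right; exists s1, l, (s2 ++ descent k (M.+1 - k)); split.
    by apply: BraidTrans tjE _; have := braid_eq_catr (descent k (M.+1 - k)) sE;
       rewrite -!catA.
  by have := braid_eq_catr (descent k (M.+1 - k)) tE; rewrite -!catA.
have [ik|ki] := ltnP i k.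
  have [kE|ik1] := eqVneq i.+1 k.
    left; exists (t ++ descent i (M.+1 - i)).
      by exists t, i; split=> //; lia.
    have -> : (M.+1 - i = (M.+1 - k).+1)%N by lia.
    by rewrite descent_rcons kE catA; apply: BraidRefl.
  apply: (enter i); first lia.
  by apply: braid_eq_commute; apply/allP => j; rewrite mem_descent; lia.
case: i ki iM enter => [|i] ki iM enter.
  right; have -> : k = 0%N by lia.
  exists (t ++ descent 1 M), 0%N, [::].
  by rewrite subn0 descent_rcons -!catA; split; apply: BraidRefl.
have [kE|ik1] := eqVneq k i.+1.
  right; exists (t ++ descent k.+1 (M - k)), k, [::].
  have -> : (M.+1 - k = (M - k).+1)%N by lia.
  by rewrite descent_rcons -!catA -kE; split; apply: BraidRefl.
by apply: (enter i); [lia|apply: descent_slide; lia].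
Qed.

(** * Words of simple transpositions *)

Section Permutations.
Variable N : nat.

Definition simple_transp (i : nat) : 'S_N.+1 := tperm (inord i) (inord i.+1).

Definition perm_word (s : seq nat) : 'S_N.+1 := (\prod_(i <- s) simple_transp i)%g.

Lemma perm_word_cat s t : perm_word (s ++ t) = (perm_word s * perm_word t)%g.
Proof. exact: big_cat. Qed.

Lemma perm_word_square i : perm_word [:: i; i] = 1%g.
Proof. by rewrite /perm_word !big_cons big_nil mulg1 tperm2. Qed.

Lemma simple_transp_far i j : (i < N)%N -> (j < N)%N ->
  (i.+1 < j)%N || (j.+1 < i)%N ->
  (simple_transp i * simple_transp j = simple_transp j * simple_transp i)%g.
Proof.
move=> iN jN ij; rewrite /simple_transp conjgC tpermJ.
by rewrite !tpermD // -val_eqE /= !inordK; lia.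
Qed.

Lemma simple_transp_near i : (i.+1 < N)%N ->
  (simple_transp i * simple_transp i.+1 * simple_transp i =
   simple_transp i.+1 * simple_transp i * simple_transp i.+1)%g.
Proof.
move=> iN; have conjE (x y : 'S_N.+1) : (y^-1 = y -> y * x * y = x ^ y)%g.
  by move=> yV; rewrite /conjg yV mulgA.
rewrite !conjE ?tpermV // /simple_transp !tpermJ tpermR tpermL.
by rewrite [in LHS]tpermD ?[in RHS]tpermD // -val_eqE /= !inordK; lia.
Qed.

Lemma perm_word_braid_eq s t : braid_eq s t -> all (fun i => (i < N)%N) s ->
  perm_word s = perm_word t.
Proof.
elim=> // [s1 s2 s3 s12 H1 _ H2 s1N|i j s1 s2 ij|i j s1 s2 ij].
- by rewrite H1 // H2 // -(braid_eq_all _ s12).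
- rewrite !perm_word_cat !all_cat /= => /and3P[_ /and3P[iN jN _] _].
  congr (_ * (_ * _))%g.
  by rewrite /perm_word !big_cons big_nil !mulg1 simple_transp_far.
- rewrite !perm_word_cat !all_cat /= => /and3P[_ /and4P[iN jN _ _] _].
  congr (_ * (_ * _))%g.
  rewrite /perm_word !big_cons big_nil !mulg1 !mulgA.
  by case/orP: ij iN jN => /eqP -> iN jN; rewrite simple_transp_near.
Qed.

Lemma perm_word_fix s (x : 'I_N.+1) :
  all (fun i => (i.+1 < x)%N) s -> perm_word s x = x.
Proof.
elim: s => [_|i s IH] /=; first by rewrite /perm_word big_nil perm1.
case/andP=> ix /IH sx; have := ltn_ord x => xN.
by rewrite /perm_word big_cons permM tpermD ?sx // -val_eqE /= inordK; lia.
Qed.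

Lemma perm_word_descent k m : (k + m <= N)%N ->
  perm_word (descent k m) (inord (k + m)) = inord k.
Proof.
elim: m => [|m IH] kmN; first by rewrite addn0 /perm_word big_nil perm1.
rewrite descent_cons /perm_word big_cons permM addnS tpermR; apply: IH; lia.
Qed.

(** The last block of a staircase word is the only one that moves the last
    point, and it moves it to the position of its lowest letter. *)
Lemma staircase_perm_inj M s t : (M <= N)%N -> staircase M s -> staircase M t ->
  perm_word s = perm_word t -> s = t.
Proof.
elim: M s t => [|M IH] s t MN; first by move=> /= -> ->.
move=> [s1 [k [s1M kM sE]]] [t1 [l [t1M lM tE]]] st.
have val_last r c : staircase M r -> (c <= M.+1)%N ->
    perm_word (r ++ descent c (M.+1 - c)) (inord M.+1) = inord c.
  move=> rM cM; rewrite perm_word_cat permM (@perm_word_fix r).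
    by have := @perm_word_descent c (M.+1 - c); rewrite subnKC // => ->.
  by apply: sub_all (staircase_all rM) => i; rewrite inordK.
have kl : k = l.
  have : perm_word s (inord M.+1) = perm_word t (inord M.+1) by rewrite st.
  by rewrite sE tE !val_last // => /(congr1 val); rewrite /= !inordK //; lia.
move: st; rewrite sE tE kl !perm_word_cat => /mulIg /(IH _ _ (ltnW MN) s1M t1M).
by move=> ->.
Qed.

Definition reduced (s : seq nat) : Prop :=
  all (fun i => (i < N)%N) s /\
  forall t, all (fun i => (i < N)%N) t -> perm_word t = perm_word s ->
    (size s <= size t)%N.

(** Insert the letters one at a time: a repetition on the way could be deleted
    without changing the permutation, which a reduced word excludes. *)
Lemma reduced_staircase s : reduced s ->
  exists2 t, staircase N t & braid_eq s t.
Proof.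
elim/last_ind: s => [_|s i IH [sN smin]].
  suff [t tN] : exists2 t, staircase N t & t = [::].
    by move=> tE; exists t => //; rewrite tE; apply: BraidRefl.
  elim: (N) => [|M [t tM t0]]; first by exists [::].
  exists [::] => //; exists [::], M.+1; rewrite -{1}t0.
  by split=> //; rewrite subnn.
move: sN smin; rewrite -cats1 all_cat /= andbT => /andP[sN iN] smin.
have [|t tN st] := IH.
  split=> // r rN rs; have := smin (r ++ [:: i]).
  by rewrite all_cat rN /= iN !size_cat !addn1 !perm_word_cat rs => /(_ isT erefl).
case: (staircase_insert tN iN) => [[t' t'N tt']|[s1 [j [s2 [tE _]]]]].
  by exists t' => //; apply: BraidTrans tt'; apply: braid_eq_catr.
have sE : braid_eq (s ++ [:: i]) (s1 ++ [:: j; j] ++ s2).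
  by apply: BraidTrans tE; apply: braid_eq_catr.
have siN : all (fun i => (i < N)%N) (s ++ [:: i]) by rewrite all_cat sN /= iN.
have := siN; rewrite (braid_eq_all _ sE) !all_cat => /and3P[s1N _ s2N].
have := smin (s1 ++ s2); rewrite all_cat s1N s2N (perm_word_braid_eq sE siN).
rewrite (braid_eq_size sE) !perm_word_cat.
rewrite perm_word_square mul1g !size_cat /=.
by move=> /(_ isT erefl); lia.
Qed.

(** A shortest word of the same permutation is connected by length-preserving
    moves to a staircase word, which is [t] itself by uniqueness. *)
Lemma staircase_reduced t : staircase N t -> reduced t.
Proof.
move=> tN; have tall := staircase_all tN.
pose P m := `[< exists2 s,
  all (fun i => (i < N)%N) s /\ perm_word s = perm_word t & size s = m >].
have exP : exists m, P m by exists (size t); apply/asboolP; exists t.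
case: (ex_minnP exP) => m /asboolP[s [sN sE] sm] mmin.
have smin r : all (fun i => (i < N)%N) r -> perm_word r = perm_word t ->
    (size s <= size r)%N.
  by move=> rN rE; rewrite sm; apply: mmin; apply/asboolP; exists r.
have [|t' t'N st'] := @reduced_staircase s.
  by split=> // r rN rE; apply: smin; rewrite // rE.
have tE : t' = t.
  apply: (staircase_perm_inj (leqnn N)) => //.
  by rewrite -sE (perm_word_braid_eq st').
by split=> // r rN rE; rewrite -tE -(braid_eq_size st'); apply: smin.
Qed.

End Permutations.

(** * Continuity on a subset *)

Definition cont_on (Y Z : topologicalType) (B : set Y) (h : Y -> Z) : Prop :=
  forall y, B y -> h @ within B (nbhs y) --> h y.

Section RelativeContinuity.
Variables (R : realType) (X : topologicalType) (A : set X).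

Lemma cont_on_cst (c : R) : cont_on A (fun=> c).
Proof. by move=> x _; apply: cvg_cst. Qed.

Lemma cont_onD (f g : X -> R) :
  cont_on A f -> cont_on A g -> cont_on A (fun x => f x + g x).
Proof. by move=> fc gc x Ax; apply: (cvgD (fc x Ax) (gc x Ax)). Qed.

Lemma cont_onN (f : X -> R) : cont_on A f -> cont_on A (fun x => - f x).
Proof. by move=> fc x Ax; apply: (cvgN (fc x Ax)). Qed.

Lemma cont_onM (f g : X -> R) :
  cont_on A f -> cont_on A g -> cont_on A (fun x => f x * g x).
Proof. by move=> fc gc x Ax; apply: (cvgM (fc x Ax) (gc x Ax)). Qed.

Lemma cont_on_div (f g : X -> R) : (forall x, A x -> g x != 0) ->
  cont_on A f -> cont_on A g -> cont_on A (fun x => f x / g x).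
Proof.
by move=> g0 fc gc x Ax; apply: (cvgM (fc x Ax) (cvgV (g0 x Ax) (gc x Ax))).
Qed.

Lemma cont_on_sum (I : Type) (r : seq I) (f : I -> X -> R) :
  (forall i, cont_on A (f i)) -> cont_on A (fun x => \sum_(i <- r) f i x).
Proof.
move=> fc; elim: r => [|i r IH].
  have -> : (fun x => \sum_(i <- [::]) f i x) = (fun=> 0 : R).
    by apply/funext => x; rewrite big_nil.
  exact: cont_on_cst.
have -> : (fun x => \sum_(j <- i :: r) f j x) =
          (fun x => f i x + \sum_(j <- r) f j x).
  by apply/funext => x; rewrite big_cons.
exact: cont_onD.
Qed.

Lemma cont_on_mx (p q : nat) (F : X -> 'M[R]_(p, q)) :
  (forall i j, cont_on A (fun x => F x i j)) -> cont_on A F.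
Proof.
move=> Fc x Ax t [P FP sub] /=.
have entries : \forall y \near within A (nbhs x), forall i j, P i j (F y i j).
  apply: (@filter_forall _ _ (fun i y => forall j, P i j (F y i j))) => i.
  apply: (@filter_forall _ _ (fun j y => P i j (F y i j))) => j.
  exact: (Fc i j x Ax _ (FP i j)).
by apply: filterS entries => y yP; apply: sub.
Qed.

Lemma cont_on_coord (p q : nat) (F : X -> 'M[R]_(p, q)) i j :
  cont_on A F -> cont_on A (fun x => F x i j).
Proof.
move=> Fc x Ax t tP; apply: (Fc x Ax [set M | t (M i j)]).
exact: (@coord_continuous _ _ _ i j (F x) t tP).
Qed.

Lemma cont_on_mulmx (p q r : nat) (F : X -> 'M[R]_(p, q)) (G : X -> 'M[R]_(q, r)) :
  cont_on A F -> cont_on A G -> cont_on A (fun x => F x *m G x).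
Proof.
move=> Fc Gc; apply: cont_on_mx => i j.
have -> : (fun x => (F x *m G x) i j) = (fun x => \sum_k F x i k * G x k j).
  by apply/funext => x; rewrite mxE.
by apply: cont_on_sum => k; apply: cont_onM; apply: cont_on_coord.
Qed.

Lemma cont_on_id : cont_on A (fun x => x).
Proof. by move=> x _; apply: cvg_within. Qed.

Lemma cont_on_comp (Y Z : topologicalType) (B : set Y) (f : X -> Y) (h : Y -> Z) :
  (forall x, A x -> B (f x)) -> cont_on A f -> cont_on B h ->
  cont_on A (fun x => h (f x)).
Proof.
move=> fAB fc hc x Ax t ht.
have := hc (f x) (fAB x Ax) t ht => /(fc x Ax) /=.
rewrite /nbhs /= /within /=.
by apply: filterS => y Hy Ay; apply: Hy => //; apply: fAB.
Qed.

End RelativeContinuity.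

(** * The generators as rank-one matrices *)

Section Generators.
Variables (R : realType) (n : nat).
Local Notation mat := 'M[R]_(n + n).
Local Notation eps := (@eps R n).
Local Notation avec := (@avec R n).
Local Notation elgen := (@elgen R n).

Definition gen_col (i : nat) : 'cV[R]_(n + n) :=
  if odd i then col_mx 0 (eps i./2) else col_mx (avec i./2) 0.

Definition gen_row (i : nat) : 'rV[R]_(n + n) :=
  if odd i then row_mx (eps i./2)^T 0 else row_mx 0 (avec i./2)^T.

(** The basis dual to [avec 0], [avec 1], ...: since [avec j] is the sum of two
    consecutive standard vectors, the alternating signs cancel all its
    pairings but one. *)
Definition avec_dual (i : nat) : 'rV[R]_n :=
  \row_(j < n) (if (i <= j)%N then (-1) ^+ (j - i) else 0).

(** The rows [col_dual i] are dual to the columns [gen_col i], and below the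
    columns [row_dual i] are dual to the rows [gen_row i]. *)
Definition col_dual (i : nat) : 'rV[R]_(n + n) :=
  if odd i then row_mx 0 (eps i./2)^T else row_mx (avec_dual i./2) 0.

Definition row_dual (i : nat) : 'cV[R]_(n + n) :=
  if odd i then col_mx (eps i./2) 0 else col_mx 0 (avec_dual i./2)^T.

Lemma elgenE i : elgen i = gen_col i *m gen_row i.
Proof.
rewrite /Defs.elgen /gen_col /gen_row /bvec.
by case: odd; rewrite mul_col_row ?mul0mx ?mulmx0.
Qed.

Lemma mulmx_eps (u : 'rV[R]_n) j (jn : (j < n)%N) :
  u *m eps j = (u 0 (Ordinal jn))%:M.
Proof.
apply/matrixP => p q; rewrite !ord1 !mxE (bigD1 (Ordinal jn)) //= mxE eqxx mulr1.
rewrite big1 ?addr0 ?mulr1n // => k /negPf; rewrite -val_eqE mxE /= => ->.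
by rewrite mulr0.
Qed.

Lemma eps_dot i j : (j < n)%N -> (eps i)^T *m eps j = (i == j)%:R%:M.
Proof. by move=> jn; rewrite mulmx_eps !mxE /= eq_sym. Qed.

Lemma avec_dot_eps i j : (j < n)%N ->
  (avec i)^T *m eps j = ((i == j) || (i == j.+1))%:R%:M.
Proof.
move=> jn; case: i => [|i] /=; first by rewrite eps_dot // orbF.
rewrite raddfD mulmxDl !eps_dot // -raddfD /= eqSS; congr (_%:M).
by case: eqP => [->|_]; case: eqP => //= [ij|_]; rewrite ?addr0 ?add0r //; lia.
Qed.

Lemma avec_dual_dot i j : (j < n)%N -> avec_dual i *m avec j = (i == j)%:R%:M.
Proof.
case: j => [|j] jn /=.
  by rewrite mulmx_eps mxE /= leqn0; case: eqP => [->|].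
rewrite mulmxDr (mulmx_eps _ (ltnW jn)) mulmx_eps !mxE /= -raddfD /=.
congr (_%:M); case: (ltngtP i j.+1) => ij.
- by rewrite ltnS in ij; rewrite ij subSn // exprS mulN1r subrr.
- by rewrite leqNgt (ltnW ij) /= addr0.
- by rewrite ij ltnn subnn expr0 add0r.
Qed.

Lemma gen_row_col i j : (i < 2 * n)%N -> (j < 2 * n)%N ->
  gen_row i *m gen_col j = ((i == j.+1) || (j == i.+1))%:R%:M.
Proof.
move=> iN jN; rewrite /gen_row /gen_col.
case: ifP => io; case: ifP => jo; rewrite mul_row_col ?mulmx0 ?mul0mx ?addr0 ?add0r.
- by rewrite (_ : (_ || _) = false) ?mul0mx ?scalemx0; [rewrite raddf0|lia].
- have jn : (i./2 < n)%N by lia.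
  rewrite -[LHS]trmxK trmx_mul trmxK avec_dot_eps // tr_scalar_mx.
  by congr (_%:R%:M); congr nat_of_bool; lia.
- by rewrite avec_dot_eps; [congr (_%:R%:M); congr nat_of_bool|]; lia.
- by rewrite (_ : (_ || _) = false) ?mul0mx ?scalemx0; [rewrite raddf0|lia].
Qed.

Lemma col_dualP i j : (i < 2 * n)%N -> (j < 2 * n)%N ->
  col_dual i *m gen_col j = (i == j)%:R%:M.
Proof.
move=> iN jN; rewrite /col_dual /gen_col.
case: ifP => io; case: ifP => jo; rewrite mul_row_col ?mulmx0 ?mul0mx ?addr0 ?add0r.
- by rewrite eps_dot; [congr (_%:R%:M); congr nat_of_bool|]; lia.
- by rewrite (_ : (_ == _) = false) ?raddf0 //; lia.
- by rewrite (_ : (_ == _) = false) ?raddf0 //; lia.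
- by rewrite avec_dual_dot; [congr (_%:R%:M); congr nat_of_bool|]; lia.
Qed.

Lemma row_dualP i j : (i < 2 * n)%N -> (j < 2 * n)%N ->
  gen_row i *m row_dual j = (i == j)%:R%:M.
Proof.
move=> iN jN; rewrite /row_dual /gen_row.
case: ifP => io; case: ifP => jo; rewrite mul_row_col ?mulmx0 ?mul0mx ?addr0 ?add0r.
- by rewrite eps_dot; [congr (_%:R%:M); congr nat_of_bool|]; lia.
- by rewrite (_ : (_ == _) = false) ?raddf0 //; lia.
- by rewrite (_ : (_ == _) = false) ?raddf0 //; lia.
- rewrite -trmx_mul avec_dual_dot ?tr_scalar_mx; last lia.
  by congr (_%:R%:M); congr nat_of_bool; lia.
Qed.

Lemma elgenM i j : (i < 2 * n)%N -> (j < 2 * n)%N ->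
  elgen i *m elgen j =
  ((i == j.+1) || (j == i.+1))%:R *: (gen_col i *m gen_row j).
Proof.
move=> iN jN; rewrite !elgenE mulmxA -(mulmxA (gen_col i)) gen_row_col //.
by rewrite mul_mx_scalar -scalemxAl.
Qed.

Lemma elgen_sqr i : elgen i *m elgen i = 0.
Proof.
rewrite /Defs.elgen; case: odd; rewrite mulmx_block ?mulmx0 ?mul0mx ?addr0;
by rewrite ?mulmx0 ?mul0mx ?addr0 block_mx_const.
Qed.

Lemma elgen_far i j : (i < 2 * n)%N -> (j < 2 * n)%N ->
  (i.+1 < j)%N || (j.+1 < i)%N -> elgen i *m elgen j = 0.
Proof.
move=> iN jN ij; rewrite elgenM // (_ : (_ || _) = false) ?scale0r //.
by apply/negbTE; lia.
Qed.

Lemma elgen_near i j : (i < 2 * n)%N -> (j < 2 * n)%N ->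
  (j == i.+1) || (i == j.+1) -> elgen i *m elgen j *m elgen i = elgen i.
Proof.
move=> iN jN ij; rewrite elgenM // orbC ij scale1r (elgenE i).
rewrite mulmxA -(mulmxA (gen_col i)) gen_row_col //.
by rewrite ij mul_mx_scalar scale1r.
Qed.

(** * Products of one-parameter subgroups *)

Definition ugen (i : nat) (c : R) : mat := 1%:M + c *: elgen i.

Lemma ugen0 i : ugen i 0 = 1%:M.
Proof. by rewrite /ugen scale0r addr0. Qed.

Lemma ugenM i c d : ugen i c *m ugen i d = ugen i (c + d).
Proof.
rewrite /ugen mulmxDl mul1mx mulmxDr mulmx1 -scalemxAl -scalemxAr elgen_sqr.
by rewrite !scaler0 addr0 scalerDl -addrA [d *: _ + _]addrC.
Qed.

Lemma ugen_far i j c d : (i < 2 * n)%N -> (j < 2 * n)%N ->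
  (i.+1 < j)%N || (j.+1 < i)%N -> ugen i c *m ugen j d = ugen j d *m ugen i c.
Proof.
move=> iN jN ij; rewrite /ugen !(mulmxDl, mulmxDr) !(mul1mx, mulmx1).
rewrite -!scalemxAl -!scalemxAr !elgen_far // 1?orbC // !scaler0 !addr0.
by rewrite -!addrA [c *: _ + _]addrC.
Qed.

(** With [E] and [F] the two generators, [EFE = E] and [FEF = F] reduce both
    sides to combinations of 1, [E], [F], [EF] and [FE]; the hypotheses compare
    the coefficients. *)
Lemma ugen_near i j (a b c a' b' c' : R) : (i < 2 * n)%N -> (j < 2 * n)%N ->
  (j == i.+1) || (i == j.+1) ->
  b' = a + c + a * b * c -> b = a' + c' + a' * b' * c' ->
  a' * b' = b * c -> b' * c' = a * b ->
  ugen i a *m ugen j b *m ugen i c = ugen j a' *m ugen i b' *m ugen j c'.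
Proof.
move=> iN jN ij Eb' Eb Eab Ebc.
have near_prod k l (x y z : R) : (k < 2 * n)%N -> (l < 2 * n)%N ->
    (l == k.+1) || (k == l.+1) ->
    ugen k x *m ugen l y *m ugen k z =
    1%:M + (x + z + x * y * z) *: elgen k + y *: elgen l +
    (x * y) *: (elgen k *m elgen l) + (y * z) *: (elgen l *m elgen k).
  move=> kN lN kl; rewrite /ugen !(mulmxDl, mulmxDr) !(mul1mx, mulmx1).
  rewrite -!scalemxAl -!scalemxAr -!scalemxAl elgen_near // elgen_sqr.
  set K := elgen k; set L := elgen l; set KL := K *m L; set LK := L *m K.
  (* Naming the products keeps their entries atomic for [ring]. *)
  by apply/matrixP => p q; rewrite !mxE; ring.
rewrite near_prod // near_prod // 1?orbC // -Eb' -Eb Eab Ebc.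
set K := elgen i; set L := elgen j; set KL := K *m L; set LK := L *m K.
by apply/matrixP => p q; rewrite !mxE; ring.
Qed.

Definition uprod (s : seq nat) (a : seq R) : mat :=
  foldr (fun p x => ugen p.1 p.2 *m x) 1%:M (zip s a).

Lemma uprod_cons i s c a : uprod (i :: s) (c :: a) = ugen i c *m uprod s a.
Proof. by []. Qed.

Lemma uprod_cat s t a b : size s = size a ->
  uprod (s ++ t) (a ++ b) = uprod s a *m uprod t b.
Proof.
elim: s a => [|i s IH] [|c a] //= => [_|[sa]]; first by rewrite mul1mx.
by rewrite !uprod_cons IH // mulmxA.
Qed.

Lemma uprod_inv s a : size s = size a ->
  uprod s a *m uprod (rev s) (rev (map -%R a)) = 1%:M.
Proof.
elim: s a => [|i s IH] [|c a] //= => [_|[sa]]; first by rewrite /uprod mulmx1.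
rewrite !rev_cons -!cats1 uprod_cat ?size_rev ?size_map // uprod_cons.
rewrite mulmxA -(mulmxA (ugen i c)) IH // mulmx1 uprod_cons /uprod /= mulmx1.
by rewrite ugenM subrr ugen0.
Qed.

(** * The exponential and the symplectic form *)

Lemma expmx_sqr0 (m : nat) (A : 'M[R]_m) : A *m A = 0 -> expmx A = 1%:M + A.
Proof.
move=> A0; rewrite /expmx; apply: lim_near_cst; first exact: norm_hausdorff.
exists 2%N => // k /= k2; rewrite /series /= (big_cat_nat (n := 2)) //=.
have -> : \sum_(2 <= j < k) (j`!%:R^-1 : R) *: A ^+ j = 0.
  rewrite big_nat_cond big1 // => -[|[|j]] //= _.
  by rewrite !exprS mulrA (_ : A * A = 0) ?mul0r ?scaler0.
by rewrite addr0 !big_nat_recr //= big_nil add0r fact0 invr1 !scale1r.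
Qed.

Lemma uelE (i : 'I_(2 * n)) (c : R) : uel i c = ugen i c.
Proof.
by rewrite /uel expmx_sqr0 // -scalemxAl -scalemxAr elgen_sqr !scaler0.
Qed.

Lemma ugen_EL i c : @EL R n (ugen i c).
Proof.
rewrite /EL /= /ugen [(_ + _)^T]raddfD /= trmx1 linearZ /=.
set e := elgen i; set J := sympJ R n.
have eJe : e^T *m J *m e = 0 /\ e^T *m J + J *m e = 0.
  rewrite /e /J /Defs.elgen /sympJ.
  case: odd; rewrite tr_block_mx !trmx0 trmx_mul trmxK !mulmx_block;
  rewrite ?(mulmx0, mul0mx, addr0, add0r, mulmx1, mul1mx, mulmxN, mulNmx);
  by rewrite ?add_block_mx ?(addr0, add0r, subrr, addNr, oppr0) block_mx_const.
case: eJe => eJe eJ.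
rewrite !(mulmxDl, mulmxDr) !(mul1mx, mulmx1).
rewrite -!scalemxAl -!scalemxAr eJe !scaler0 addr0.
by rewrite -addrA -scalerDr eJ scaler0 addr0.
Qed.

(** * Cells *)

Definition params (s : seq nat) (a : seq R) : bool :=
  (size s == size a) && all (fun c => 0 < c) a.

Definition cell (s : seq nat) : set mat :=
  [set uprod s a | a in [set a | params s a]].

Lemma params_size s a : params s a -> size s = size a.
Proof. by case/andP=> /eqP. Qed.

Lemma params_cat s t a b :
  params s a -> params t b -> params (s ++ t) (a ++ b).
Proof.
case/andP=> /eqP sa apos /andP[/eqP tb bpos].
by rewrite /params !size_cat sa tb eqxx all_cat apos.
Qed.

Lemma params_split s t a : params (s ++ t) a ->
  exists b c, [/\ a = b ++ c, params s b & params t c].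
Proof.
case/andP=> /eqP; rewrite size_cat => sa.
rewrite -{1}(cat_take_drop (size s) a) all_cat => /andP[tpos dpos].
have st : size (take (size s) a) = size s by rewrite size_takel // -sa leq_addr.
exists (take (size s) a), (drop (size s) a); split; first by rewrite cat_take_drop.
  by rewrite /params st eqxx.
by rewrite /params dpos size_drop -sa addKn eqxx.
Qed.

(** * Reading the last block off a product *)

Lemma uprod_fix (r : 'rV[R]_(n + n)) s a :
  (forall i, i \in s -> r *m gen_col i = 0) -> r *m uprod s a = r.
Proof.
elim: s a => [|i s IH] [|c a] rs; rewrite ?mulmx1 //.
rewrite uprod_cons mulmxA /ugen mulmxDr mulmx1 -scalemxAr elgenE mulmxA.
rewrite rs ?mem_head // mul0mx scaler0 addr0 IH // => j js.
by apply: rs; rewrite in_cons js orbT.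
Qed.

(** Each letter [i] of the block adds to [gen_row i.+1] a multiple of
    [gen_row i], so the row [gen_row j] appears with the product of the
    parameters met on the way down to [j]. *)
Lemma gen_row_descent k m c j :
  size c = m -> (k + m < 2 * n)%N -> (j < 2 * n)%N ->
  gen_row (k + m)%N *m uprod (descent k m) c *m row_dual j =
  (if (k <= j <= k + m)%N then \prod_(x <- take (k + m - j)%N c) x else 0)%:M.
Proof.
elim: m c => [|m IH] c cm kmN jN.
  rewrite addn0 in kmN *; rewrite (size0nil cm) /uprod /= mulmx1 row_dualP //.
  congr (_%:M).
  by rewrite -eqn_leq big_nil; case: eqP.
case: c cm => [//|c0 c] [cm].
rewrite descent_cons uprod_cons mulmxA /ugen mulmxDr mulmx1 -scalemxAr.
rewrite elgenE mulmxA.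
rewrite gen_row_col; try lia.
rewrite addnS eqxx /= mul1mx mulmxDl uprod_fix; last first.
  move=> i; rewrite mem_descent => ikm; rewrite gen_row_col; try lia.
  by rewrite (_ : (_ || _) = false) ?raddf0 //; lia.
rewrite -scalemxAl mulmxDl -scalemxAl IH //; try lia.
rewrite row_dualP; try lia.
rewrite scale_scalar_mx -raddfD /=; congr (_%:M).
case: (ltngtP j (k + m).+1) => jkm.
- rewrite add0r (_ : (k + m).+1 - j = (k + m - j).+1)%N; last lia.
  rewrite (_ : (j <= k + m)%N = true) ?andbT; last lia.
  by case: ifP; rewrite ?mulr0 //= big_cons.
- by rewrite andbF (_ : (_ && _) = false) ?mulr0 ?addr0 //; lia.
- rewrite jkm andbT subnn take0 big_nil (_ : (_ && _) = false); last lia.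
  by rewrite mulr0 addr0 (_ : (k <= _)%N = true) //; lia.
Qed.

(** For [t > 0] this is the coefficient of [gen_row (M - t + 1)] in the row
    [col_dual M *m (x - 1)]; on products it will be the product of the first
    [t] parameters of the block that starts with the letter [M], which explains
    the value 1 for [t = 0]. *)
Definition last_coef (M t : nat) (x : mat) : R :=
  if t is t'.+1 then (col_dual M *m (x - 1%:M) *m row_dual (M - t')%N) 0 0 else 1.

Definition last_param (M t : nat) (x : mat) : R :=
  last_coef M t.+1 x / last_coef M t x.

(** The row vector [col_dual M] is fixed by all letters below [M], so only the
    last block acts on it; that block turns it into a combination of the
    linearly independent rows [gen_row M], [gen_row (M - 1)], ... whose
    coefficients are the partial products of the parameters of the block. *)
Lemma last_coefE M s k m a c t : (M < 2 * n)%N -> all (fun i => (i < M)%N) s ->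
  (k + m = M.+1)%N -> size s = size a -> size c = m -> (t <= M.+1)%N ->
  last_coef M t (uprod (s ++ descent k m) (a ++ c)) =
  if (t <= m)%N then \prod_(x <- take t c) x else 0.
Proof.
move=> MN sM kmM sa cm; case: t => [_|t tM] /=; first by rewrite take0 big_nil.
rewrite mulmxBr uprod_cat // mulmxA (@uprod_fix _ s); last first.
  move=> i si; have /= iM := allP sM i si; rewrite col_dualP; try lia.
  by rewrite (_ : (_ == _) = false) ?raddf0 //; lia.
rewrite mulmx1; case: m cm kmM => [|m] cm kmM.
  by rewrite (size0nil cm) /uprod /= mulmx1 subrr mul0mx mxE.
case: c cm => [//|c0 c] [cm].
have {}kmM : (k + m = M)%N by lia.
rewrite descent_cons uprod_cons kmM mulmxA /ugen mulmxDr mulmx1 -scalemxAr.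
rewrite elgenE mulmxA.
rewrite col_dualP // eqxx mul1mx mulmxDl uprod_fix; last first.
  move=> i; rewrite mem_descent => ikm; rewrite col_dualP; try lia.
  by rewrite (_ : (_ == _) = false) ?raddf0 //; lia.
rewrite addrC addKr -!scalemxAl -kmM gen_row_descent //; try lia.
rewrite !mxE eqxx mulr1n ltnS (_ : (_ && _) = (t <= m)%N); last lia.
by case: ifP => tm; rewrite ?mulr0 //= big_cons (_ : k + m - _ = t)%N //; lia.
Qed.

Lemma prod_take_gt0 (c : seq R) t : all (fun x => 0 < x) c ->
  0 < \prod_(x <- take t c) x.
Proof.
move=> cpos; rewrite big_seq; apply: prodr_gt0 => x /mem_take.
exact: (allP cpos).
Qed.

Lemma last_paramE M s k m a c : (M < 2 * n)%N -> all (fun i => (i < M)%N) s ->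
  (k + m = M.+1)%N -> params s a -> params (descent k m) c ->
  [seq last_param M t (uprod (s ++ descent k m) (a ++ c)) | t <- iota 0 m] = c.
Proof.
move=> MN sM kmM /params_size sa /andP[/eqP + cpos]; rewrite size_descent => cm.
apply: (@eq_from_nth _ 0); first by rewrite size_map size_iota.
move=> t; rewrite size_map size_iota => tm.
rewrite (nth_map 0%N) ?size_iota // nth_iota // add0n.
rewrite /last_param !(@last_coefE M s k m) //; try lia.
rewrite tm ltnW // (take_nth 0) -?cm // -cats1 big_cat big_seq1 /=.
by rewrite mulrAC divff ?mul1r // gt_eqF // prod_take_gt0.
Qed.

(** * Braid moves on cells *)

Definition swap_params (a : seq R) : seq R :=
  if a is [:: x; y] then [:: y; x] else a.

Definition braid_params (a : seq R) : seq R :=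
  if a is [:: x; y; z] then
    let d := x + z + x * y * z in [:: y * z / d; d; x * y / d]
  else a.

Lemma swap_paramsP i j a : (i < 2 * n)%N -> (j < 2 * n)%N ->
  (i.+1 < j)%N || (j.+1 < i)%N -> params [:: i; j] a ->
  [/\ params [:: j; i] (swap_params a),
      uprod [:: j; i] (swap_params a) = uprod [:: i; j] a &
      swap_params (swap_params a) = a].
Proof.
move=> iN jN ij; case: a => [|x [|y [|? ?]]] // /and4P[_ x0 y0 _].
split=> //; first by rewrite /params /= x0 y0.
by rewrite !uprod_cons !mulmxA (ugen_far _ _ iN jN).
Qed.

Lemma braid_den_gt0 (x y z : R) : 0 < x -> 0 < y -> 0 < z -> 0 < x + z + x * y * z.
Proof. by move=> x0 y0 z0; rewrite !addr_gt0 ?mulr_gt0. Qed.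

Lemma braid_paramsP i j a : (i < 2 * n)%N -> (j < 2 * n)%N ->
  (j == i.+1) || (i == j.+1) -> params [:: i; j; i] a ->
  [/\ params [:: j; i; j] (braid_params a),
      uprod [:: j; i; j] (braid_params a) = uprod [:: i; j; i] a &
      braid_params (braid_params a) = a].
Proof.
move=> iN jN ij; case: a => [|x [|y [|z [|? ?]]]] // /and5P[_ x0 y0 z0 _].
rewrite /braid_params; set d := x + z + x * y * z.
have d0 : 0 < d by apply: braid_den_gt0.
have dn : d != 0 by rewrite gt_eqF.
have yE : y * z / d + x * y / d + y * z / d * d * (x * y / d) = y.
  by apply: (mulIf dn); rewrite /d in dn *; field.
split.
- by rewrite /params /= !divr_gt0 ?mulr_gt0 // d0.
- rewrite /uprod /= !mulmx1 !mulmxA.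
  by apply/esym/ugen_near; rewrite ?yE // 1?divfK // mulrC divfK.
- by rewrite yE; congr [:: _; _; _]; field; rewrite dn gt_eqF.
Qed.

(** A move inside a word acts only on the parameters of the letters involved, by
    a positive change of parameters. *)
Lemma cell_braid_eq s t : all (fun i => (i < 2 * n)%N) s -> braid_eq s t ->
  cell s = cell t.
Proof.
suff sub s' t' : braid_eq s' t' -> all (fun i => (i < 2 * n)%N) s' ->
    cell s' `<=` cell t'.
  move=> sN st; apply/seteqP; split; first exact: sub.
  by apply: (sub _ _ (braid_eq_sym st)); rewrite -(braid_eq_all _ st).
have local s1 s2 m m' (f : seq R -> seq R) :
    (forall a, params m a -> params m' (f a) /\ uprod m' (f a) = uprod m a) ->
    cell (s1 ++ m ++ s2) `<=` cell (s1 ++ m' ++ s2).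
  move=> fP x [a /= /params_split[a1 [a' [-> a1P]]]].
  move=> /params_split[a2 [a3 [-> a2P a3P]]] <-.
  have [fa2P fa2] := fP _ a2P; exists (a1 ++ f a2 ++ a3).
    by do 2![apply: params_cat => //].
  by rewrite !uprod_cat ?(params_size a1P) ?(params_size a2P)
             ?(params_size fa2P) // fa2.
elim=> [r _|r1 r2 r3 st1 H1 _ H2 r1N|i j s1 s2 ij|i j s1 s2 ij].
- by [].
- by apply: subset_trans (H1 r1N) (H2 _); rewrite -(braid_eq_all _ st1).
- rewrite !all_cat => /and3P[_ /and3P[iN jN _] _].
  by apply: (local s1 s2 _ _ swap_params) => a /(swap_paramsP iN jN ij)[].
- rewrite !all_cat => /and3P[_ /and4P[iN jN _ _] _].
  by apply: (local s1 s2 _ _ braid_params) => a /(braid_paramsP iN jN ij)[].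
Qed.

(** * Continuous recovery of the parameters *)

Definition eval (g : seq (mat -> R)) (x : mat) : seq R := [seq h x | h <- g].

(** A continuous inverse of the parametrization is kept as one function for each
    letter, so that a move edits only the few entries of its letters. *)
Definition recovers (s : seq nat) (g : seq (mat -> R)) : Prop :=
  (forall a, params s a -> eval g (uprod s a) = a) /\
  List.Forall (cont_on (cell s)) g.

Lemma recovers_size s g : recovers s g -> size g = size s.
Proof.
move=> [gP _]; have sP : params s (nseq (size s) 1).
  by rewrite /params size_nseq eqxx all_nseq ltr01 orbT.
by have /(congr1 size) := gP _ sP; rewrite size_map size_nseq.
Qed.

(** Replacing the factor [m] of a word by [m'] changes only the middle part of
    the recovering functions; [F] is the change of parameters [f] performed on
    functions. *)
Lemma recovers_local s1 s2 m m' (f : seq R -> seq R)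
    (F : seq (mat -> R) -> seq (mat -> R)) :
  all (fun i => (i < 2 * n)%N) (s1 ++ m ++ s2) ->
  braid_eq (s1 ++ m ++ s2) (s1 ++ m' ++ s2) -> 
  (forall a, params m' a -> exists b,
     [/\ params m b, uprod m b = uprod m' a & f b = a]) ->
  (forall g x, size g = size m -> eval (F g) x = f (eval g x)) ->
  (forall g (A : set mat), size g = size m ->
     (forall x, A x -> all (fun c => 0 < c) (eval g x)) ->
     List.Forall (cont_on A) g -> List.Forall (cont_on A) (F g)) ->
  (exists g, recovers (s1 ++ m ++ s2) g) -> exists g, recovers (s1 ++ m' ++ s2) g.
Proof.
move=> sN ss' fP Feval Fcont [g gP]; have gsize := recovers_size gP.
case: gP; pose g1 := take (size s1) g; pose g' := drop (size s1) g.
pose g2 := take (size m) g'; pose g3 := drop (size m) g'.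
have gE : g = g1 ++ g2 ++ g3 by rewrite !cat_take_drop.
rewrite !size_cat in gsize.
have g1s : size g1 = size s1 by rewrite size_takel // gsize leq_addr.
have g's : size g' = (size m + size s2)%N by rewrite size_drop gsize addKn.
have g2s : size g2 = size m by rewrite size_takel // g's leq_addr.
rewrite gE => gP gcont.
have split_eval a1 a2 a3 : params s1 a1 -> params m a2 -> params s2 a3 ->
    let x := uprod (s1 ++ m ++ s2) (a1 ++ a2 ++ a3) in
    [/\ eval g1 x = a1, eval g2 x = a2 & eval g3 x = a3].
  move=> a1P a2P a3P x.
  have /gP : params (s1 ++ m ++ s2) (a1 ++ a2 ++ a3) by do 2!apply: params_cat => //.
  rewrite -/x /eval !map_cat => /eqP.
  rewrite eqseq_cat ?size_map ?g1s ?(params_size a1P) // => /andP[/eqP -> ].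
  by rewrite eqseq_cat ?size_map ?g2s ?(params_size a2P) // => /andP[/eqP -> /eqP ->].
exists (g1 ++ F g2 ++ g3); split=> [a|].
  move=> /params_split[a1 [a' [-> a1P]]] /params_split[a2 [a3 [-> a2P a3P]]].
  have [b [bP bE fb]] := fP _ a2P.
  have -> : uprod (s1 ++ m' ++ s2) (a1 ++ a2 ++ a3) =
            uprod (s1 ++ m ++ s2) (a1 ++ b ++ a3).
    by rewrite !uprod_cat ?(params_size a1P) ?(params_size a2P)
               ?(params_size bP) // bE.
  have [e1 e2 e3] := split_eval _ _ _ a1P bP a3P.
  by rewrite {1}/eval !map_cat -!/(eval _ _) e1 e3 Feval // e2 fb.
rewrite -(cell_braid_eq sN ss').
move: gcont => /List.Forall_app[c1 /List.Forall_app[c2 c3]].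
apply/List.Forall_app; split=> //; apply/List.Forall_app; split=> //.
apply: Fcont => // x [a /params_split[a1 [a' [-> a1P]]]].
move=> /params_split[a2 [a3 [-> a2P a3P]]] <-.
have [_ -> _] := split_eval _ _ _ a1P a2P a3P.
by case/andP: a2P.
Qed.

Lemma recovers_braid_eq s t : braid_eq s t -> all (fun i => (i < 2 * n)%N) s ->
  (exists g, recovers s g) -> exists g, recovers t g.
Proof.
elim=> [r _|r1 r2 r3 st1 H1 _ H2 r1N|i j s1 s2 ij sN|i j s1 s2 ij sN].
- by [].
- by move/(H1 r1N)/H2; apply; rewrite -(braid_eq_all _ st1).
- have := sN; rewrite !all_cat => /and3P[_ /and3P[iN jN _] _].
  pose F (g : seq (mat -> R)) := if g is [:: h; k] then [:: k; h] else g.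
  apply: (@recovers_local _ _ _ _ swap_params F) => //; first exact: BraidFar.
  + move=> a aP; have [|swP swE swK] := swap_paramsP jN iN _ aP.
      by rewrite orbC.
    by exists (swap_params a).
  + by move=> [|h [|k [|? ?]]].
  + move=> [|h [|k [|? ?]]] // A _ _ /List.Forall_cons_iff[hc].
    by move=> /List.Forall_cons_iff[kc _]; do 2!constructor => //.
- have := sN; rewrite !all_cat => /and3P[_ /and4P[iN jN _ _] _].
  pose F (g : seq (mat -> R)) := if g is [:: h; k; l] then
    let d := fun x => h x + l x + h x * k x * l x in
    [:: (fun x => k x * l x / d x); d; (fun x => h x * k x / d x)] else g.
  apply: (@recovers_local _ _ _ _ braid_params F) => //; first exact: BraidNear.
  + move=> a aP; have [|brP brE brK] := braid_paramsP jN iN _ aP.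
      by rewrite orbC.
    by exists (braid_params a).
  + by move=> [|h [|k [|l [|? ?]]]].
  + move=> [|h [|k [|l [|? ?]]]] // A _ gpos /List.Forall_cons_iff[hc].
    move=> /List.Forall_cons_iff[kc] /List.Forall_cons_iff[lc _].
    have dc : cont_on A (fun x => h x + l x + h x * k x * l x).
      by do ![apply: cont_onD => //|apply: cont_onM => //].
    have d0 x : A x -> h x + l x + h x * k x * l x != 0.
      by move=> /gpos /and4P[? ? ? _]; rewrite gt_eqF // braid_den_gt0.
    have quot (f : mat -> R) : cont_on A f -> cont_on A
        (fun x => f x / (h x + l x + h x * k x * l x)).
      by move=> fc; apply: cont_on_div.
    apply: List.Forall_cons; first by apply: quot; apply: cont_onM.
    apply: List.Forall_cons => //.
    by apply: List.Forall_cons => //; apply: quot; apply: cont_onM.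
Qed.

(** * Products along staircase words *)

Lemma cont_on_uprod (X : topologicalType) (A : set X) s (g : seq (X -> R)) :
  List.Forall (cont_on A) g -> cont_on A (fun x => uprod s [seq h x | h <- g]).
Proof.
elim: s g => [|i s IH] [|h g] gc; try by move=> x _; apply: cvg_cst.
have [hc {}gc] := (List.Forall_inv gc, List.Forall_inv_tail gc).
have -> : (fun x => uprod (i :: s) [seq k x | k <- h :: g]) =
          (fun x => ugen i (h x) *m uprod s [seq k x | k <- g]) by [].
apply: cont_on_mulmx; last exact: IH.
apply: cont_on_mx => p q.
have -> : (fun x => ugen i (h x) p q) =
          (fun x => (1%:M : mat) p q + h x * elgen i p q).
  by apply/funext => x; rewrite mxE [X in _ + X]mxE.
by apply: cont_onD; [|apply: cont_onM => //]; apply: cont_on_cst.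
Qed.

Lemma cont_on_last_coef (A : set mat) M t : cont_on A (last_coef M t).
Proof.
case: t => [|t]; first exact: cont_on_cst.
have xc : cont_on A (fun x : mat => x - 1%:M).
  apply: cont_on_mx => i j.
  have -> : (fun x : mat => (x - 1%:M) i j) = (fun x => x i j - (1%:M : mat) i j).
    by apply/funext => x; rewrite !mxE.
  by apply: cont_onD; [apply: cont_on_coord; apply: cont_on_id|apply: cont_on_cst].
have cst (p q : nat) (B : 'M[R]_(p, q)) : cont_on A (fun=> B).
  by move=> x _; apply: cvg_cst.
by apply: cont_on_coord; do 2![apply: cont_on_mulmx => //].
Qed.

(** Peeling off the last block: its parameters are read off by [last_param], the
    block is divided out, and what is left is a product along a shorter
    staircase word. *)
Lemma staircase_recovers M s : (M <= 2 * n)%N -> staircase M s ->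
  exists g, recovers s g.
Proof.
elim: M s => [|M IH] s MN.
  move=> /= ->; exists [::]; split; last exact: List.Forall_nil.
  by move=> [|? ?].
move=> [t [k [tM kM sE]]]; have [g gP] := IH t (ltnW MN) tM.
(* [p] reads off the parameters of the last block, [q] is the list of parameters
   of its inverse, and [F] divides the block out. *)
pose m := (M.+1 - k)%N; have kmM : (k + m = M.+1)%N by rewrite subnKC.
pose p := [seq last_param M i | i <- iota 0 m].
pose q := rev [seq (fun x => - h x) | h <- p].
pose F x := x *m uprod (rev (descent k m)) (eval q x).
have tall := staircase_all tM.
have pE a c : params t a -> params (descent k m) c ->
    eval p (uprod s (a ++ c)) = c.
  by move=> aP cP; rewrite /eval -map_comp sE last_paramE.
have FE a c : params t a -> params (descent k m) c ->
    F (uprod s (a ++ c)) = uprod t a.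
  move=> aP cP; have := pE _ _ aP cP; rewrite /F; set x := uprod s _ => px.
  have -> : eval q x = rev (map -%R c).
    by rewrite /q /eval map_rev -px /eval -!map_comp.
  rewrite /x sE uprod_cat ?(params_size aP) // -mulmxA uprod_inv ?mulmx1 //.
  exact: params_size cP.
have cellE x : cell s x -> exists a c,
    [/\ params t a, params (descent k m) c & x = uprod s (a ++ c)].
  by move=> [a /= ]; rewrite {1}sE => /params_split[b [c [-> bP cP]]] <-; exists b, c.
have pc : List.Forall (cont_on (cell s)) p.
  apply/List.Forall_map/List.Forall_forall => i i_in.
  have im : (i < m)%N.
    have : i \in iota 0 m by elim: iota i_in => //= ? ? ih [->|/ih];
      rewrite in_cons ?eqxx // => ->; rewrite orbT.
    by rewrite mem_iota add0n.
  apply: cont_on_div; try exact: cont_on_last_coef.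
  move=> x /cellE[a [c [aP cP ->]]].
  rewrite sE (last_coefE MN tall kmM) ?(params_size aP) -?(params_size cP);
    rewrite ?size_descent //; last lia.
  by rewrite ltnW // gt_eqF // prod_take_gt0 //; case/andP: cP.
have qc : List.Forall (cont_on (cell s)) q.
  have := pc; rewrite /q; elim: (p) => [|h r ih] /=; first by [].
  move=> /List.Forall_cons_iff[hc /ih rc]; rewrite rev_cons -cats1.
  apply/List.Forall_app; split=> //; apply: List.Forall_cons => //.
  exact: cont_onN.
have Fc : cont_on (cell s) F.
  by apply: cont_on_mulmx; [apply: cont_on_id|apply: cont_on_uprod].
have [gE gc] := gP.
exists ([seq h \o F | h <- g] ++ p); split.
  move=> a; rewrite {1}sE => /params_split[b [c [-> bP cP]]].
  rewrite /eval map_cat -/(eval p _) pE //; congr (_ ++ _).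
  by rewrite -map_comp -[RHS]gE // /eval -(FE b c).
apply/List.Forall_app; split=> //; apply/List.Forall_map.
apply: List.Forall_impl gc => h hc; apply: (cont_on_comp (B := cell t)) => //.
by move=> x /cellE[a [c [aP cP ->]]]; rewrite FE //; exists a.
Qed.

(** The last blocks agree because the number of positive values among the
    [last_coef M t] is the length of the last block plus one. *)
Lemma staircase_cell_inj M s t a b : (M <= 2 * n)%N ->
  staircase M s -> staircase M t -> params s a -> params t b ->
  uprod s a = uprod t b -> s = t.
Proof.
elim: M s t a b => [|M IH] s t a b MN; first by move=> /= -> ->.
move=> [s1 [k [s1M kM sE]]] [t1 [l [t1M lM tE]]].
rewrite sE tE => /params_split[a1 [c [-> a1P cP]]].
move=> /params_split[b1 [d [-> b1P dP]]] xy.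
have cs := params_size cP; have ds := params_size dP; rewrite !size_descent in cs ds.
have sall := staircase_all s1M; have tall := staircase_all t1M.
have klM : (k + (M.+1 - k) = M.+1)%N /\ (l + (M.+1 - l) = M.+1)%N.
  by rewrite !subnKC.
have coefs i := last_coefE (t := i) MN sall klM.1 (params_size a1P) (esym cs).
have coeft i := last_coefE (t := i) MN tall klM.2 (params_size b1P) (esym ds).
have sizes i : (i <= M.+1)%N -> (i <= M.+1 - k)%N = (i <= M.+1 - l)%N.
  move=> iM; have := coefs i iM; rewrite xy coeft //.
  have cpos := @prod_take_gt0 c i; have dpos := @prod_take_gt0 d i.
  case/andP: cP => _ /cpos {}cpos; case/andP: dP => _ /dpos {}dpos.
  do 2!case: ifP => // _; move=> /eqP; rewrite ?(gt_eqF cpos, gt_eqF dpos) //.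
  by rewrite eq_sym ?(gt_eqF cpos, gt_eqF dpos).
have kl : k = l.
  by have := sizes (M.+1 - k)%N; have := sizes (M.+1 - l)%N; rewrite !leqnn; lia.
subst l; congr (_ ++ _).
have cd : c = d.
  rewrite -(last_paramE MN sall klM.1 a1P cP) xy.
  exact: (last_paramE MN tall klM.1 b1P dP).
apply: (IH _ _ a1 b1 (ltnW MN) s1M t1M a1P b1P).
move: xy; rewrite -cd !uprod_cat ?(params_size a1P) ?(params_size b1P) //.
move/(congr1 (fun x => x *m uprod (rev (descent k (M.+1 - k))) (rev (map -%R c)))).
by rewrite -!mulmxA !uprod_inv ?(params_size cP) // !mulmx1.
Qed.

(** Appending a letter to a staircase word either lengthens it or, after braid
    moves, repeats a letter, and then the two factors merge into one. *)
Lemma uprod_staircase s a : all (fun i => (i < 2 * n)%N) s -> params s a ->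
  exists2 t, staircase (2 * n) t & cell t (uprod s a).
Proof.
elim/last_ind: s a => [|s i IH] a.
  move=> _ aP; have red : reduced (2 * n) [::] by [].
  have [t tN tE] := reduced_staircase red.
  by exists t => //; rewrite -(cell_braid_eq _ tE) //; exists a.
rewrite -cats1 all_cat /= andbT => /andP[sN iN] /params_split[b [c [-> bP cP]]].
have [t tN [b' b'P bE]] := IH b sN bP.
have tall := staircase_all tN.
have tiN : all (fun i => (i < 2 * n)%N) (t ++ [:: i]) by rewrite all_cat tall /= iN.
have xE : cell (t ++ [:: i]) (uprod (s ++ [:: i]) (b ++ c)).
  exists (b' ++ c); first exact: params_cat.
  by rewrite !uprod_cat ?(params_size bP) ?(params_size b'P) // bE.
case: (staircase_insert tN iN) => [[t' t'N tE]|[s1 [j [s2 [tE1 tE2]]]]].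
  by exists t' => //; rewrite -(cell_braid_eq tiN tE).
exists t => //; rewrite (cell_braid_eq tall tE2).
move: xE; rewrite (cell_braid_eq tiN tE1).
move=> [d /params_split[d1 [d' [-> d1P]]] /params_split[d2 [d3 [-> d2P d3P]]] <-].
case: d2 d2P => [|x [|y [|? ?]]] // /and4P[_ x0 y0 _].
have xyP : params [:: j] [:: x + y] by rewrite /params /= addr_gt0.
exists (d1 ++ [:: x + y] ++ d3); first by do 2![apply: params_cat => //].
rewrite !uprod_cat ?(params_size d1P) // /uprod /= -/(uprod _ _) !mulmx1.
by rewrite ugenM.
Qed.

(** * The cells of the electrical group *)

Lemma uprod_EL_ge0 s a : (0 < n)%N -> all (fun i => (i < 2 * n)%N) s ->
  params s a -> EL_ge0 R n (uprod s a).
Proof.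
move=> n0 sN aP A [[_ AM] Agen].
have Au i c : (i < 2 * n)%N -> 0 <= c -> A (ugen i c).
  move=> iN c0; apply: Agen => /=; exists (Ordinal iN), c => //.
  by rewrite uelE.
have n2 : (0 < 2 * n)%N by rewrite muln_gt0.
elim: s a sN aP => [|i s IH] [|c a] // => [_ _|/= /andP[iN sN]].
  by rewrite /uprod /= -(ugen0 0); apply: Au.
move=> /and3P[/eqP[sa] c0 apos]; rewrite uprod_cons; apply: AM.
  by apply: Au => //; apply: ltW.
by apply: IH => //; rewrite /params sa eqxx.
Qed.

(** The products with positive parameters form a semigroup; a zero parameter
    contributes the identity, the product of the empty word. *)
Lemma EL_ge0_uprod x : EL_ge0 R n x ->
  exists s a, [/\ all (fun i => (i < 2 * n)%N) s, params s a & x = uprod s a].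
Proof.
pose A := [set x : mat | exists s a,
  [/\ all (fun i => (i < 2 * n)%N) s, params s a & x = uprod s a]].
apply: (@smallest_sub _ (@subsemigroup_of_EL R n) _ A); last first.
  move=> y [i [c]]; rewrite le_eqVlt => /predU1P[<-|c0] ->; rewrite uelE.
    by exists [::], [::]; rewrite ugen0.
  exists [:: (i : nat)], [:: c]; split; first by rewrite /= ltn_ord.
    by rewrite /params /= c0.
  by rewrite /uprod /= mulmx1.
split=> [y|y z].
  move=> [s [a [_ _ ->]]]; elim: s a => [|i s IH] [|c a];
    try by rewrite /EL /= /uprod /= trmx1 mul1mx mulmx1.
  rewrite uprod_cons /EL /= trmx_mul.
  have := ugen_EL i c; have := IH a; rewrite /EL /= => sE uE.
  by rewrite -[RHS]sE -[in RHS]uE !mulmxA.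
move=> [s [a [sN aP ->]]] [t [b [tN bP ->]]].
exists (s ++ t), (a ++ b); split; first by rewrite all_cat sN.
  exact: params_cat.
by rewrite uprod_cat // (params_size aP).
Qed.

Definition word (s : seq 'I_(2 * n)) : seq nat := [seq val i | i <- s].

Definition entries (l : nat) (a : 'rV[R]_l) : seq R := [seq a 0 k | k <- enum 'I_l].

Lemma word_all s : all (fun i => (i < 2 * n)%N) (word s).
Proof. by rewrite all_map; apply/allP => i _ /=. Qed.

Lemma word_surj t : all (fun i => (i < 2 * n)%N) t -> exists s, word s = t.
Proof.
elim: t => [_|i t IH /= /andP[iN /IH[s sE]]]; first by exists [::].
by exists (Ordinal iN :: s); rewrite /word /= -/(word s) sE.
Qed.

Lemma word_permE s : word_perm s = perm_word (2 * n) (word s).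
Proof.
rewrite /perm_word big_map; apply: eq_bigr => i _.
rewrite /stransp /simple_transp; have iN := ltn_ord i.
by congr tperm; apply: val_inj; rewrite /= inordK //; lia.
Qed.

Lemma reduced_wordP w s : reduced_word w s <->
  perm_word (2 * n) (word s) = w /\ reduced (2 * n) (word s).
Proof.
rewrite /reduced_word word_permE; split=> [[<- smin]|[<- [_ smin]]]; split=> //.
  split=> [|t tN]; first exact: word_all.
  have [r <-] := word_surj tN; rewrite -(word_permE r) !size_map.
  exact: smin.
move=> t; rewrite word_permE => tE.
by have := smin _ (word_all t) tE; rewrite !size_map.
Qed.

Lemma size_entries l (a : 'rV[R]_l) : size (entries a) = l.
Proof. by rewrite size_map size_enum_ord. Qed.

Lemma nth_entries l (a : 'rV[R]_l) (k : 'I_l) : nth 0 (entries a) k = a 0 k.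
Proof. by rewrite (nth_map k) ?size_enum_ord // nth_ord_enum. Qed.

Lemma entries_row l (c : seq R) : size c = l ->
  entries (\row_(k < l) nth 0 c k) = c.
Proof.
move=> cl; apply: (@eq_from_nth _ 0); first by rewrite size_entries.
move=> k; rewrite size_entries => kl.
by have := nth_entries (\row_(i < l) nth 0 c i) (Ordinal kl) => ->; rewrite mxE.
Qed.

Lemma psiE s a : psi R s a = uprod (word s) (entries a).
Proof.
have -> : word s = [seq val (tnth (in_tuple s) k) | k <- enum 'I_(size s)].
  by rewrite (map_comp val) map_tnth_enum.
rewrite /psi /entries; under eq_bigr do rewrite uelE.
pose F k := ugen (val (tnth (in_tuple s) k)) (a 0 k).
have -> : \prod_(k < size s) F k = \prod_(k <- enum 'I_(size s)) F k.
  by rewrite [index_enum _]unlock enumT.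
elim: (enum _) => [|k r IH]; first by rewrite big_nil.
by rewrite big_cons IH.
Qed.

Lemma entries_params s (a : 'rV[R]_(size s)) :
  pos_orthant R (size s) a -> params (word s) (entries a).
Proof.
move=> aP; rewrite /params size_entries size_map eqxx all_map /=.
by apply/allP => k _; apply: aP.
Qed.

Lemma psi_image s : psi R s @` pos_orthant R (size s) = cell (word s).
Proof.
apply/seteqP; split=> x.
  by move=> [a aP <-]; rewrite psiE; exists (entries a) => //; apply: entries_params.
move=> [c /= cP <-]; have cs := params_size cP; rewrite size_map in cs.
exists (\row_(k < size s) nth 0 c k); last by rewrite psiE entries_row.
by move=> k; rewrite mxE; case/andP: cP => _ /all_nthP; apply; rewrite -cs.
Qed.

Lemma reduced_word_staircase w s : reduced_word w s ->
  exists t, [/\ staircase (2 * n) t, perm_word (2 * n) t = w & braid_eq (word s) t].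
Proof.
case/reduced_wordP => sw sred; have [t tN st] := reduced_staircase sred.
by exists t; split=> //; rewrite -(perm_word_braid_eq st) // word_all.
Qed.

Lemma Ecell_cell w s : reduced_word w s -> Ecell R w = cell (word s).
Proof.
move=> sw; have [t [tN tw st]] := reduced_word_staircase sw.
apply/seteqP; split=> x; last by rewrite -psi_image; exists s.
move=> [r rw]; rewrite psi_image.
have [t' [t'N t'w rt']] := reduced_word_staircase rw.
rewrite (cell_braid_eq (word_all r) rt') (cell_braid_eq (word_all s) st).
by rewrite (staircase_perm_inj (leqnn _) t'N tN) // t'w tw.
Qed.

Lemma Ecell_disjoint : trivIset [set: 'S_(2 * n).+1] (@Ecell R n).
Proof.
move=> w w' _ _ [x [[s sw] + [s' sw']]]; rewrite !psi_image.
have [t [tN <- st]] := reduced_word_staircase sw.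
have [t' [t'N <- st']] := reduced_word_staircase sw'.
rewrite (cell_braid_eq (word_all s) st) (cell_braid_eq (word_all s') st').
move=> [a aP <-] [b bP ba].
by rewrite (staircase_cell_inj (leqnn _) tN t'N aP bP (esym ba)).
Qed.

Lemma Ecell_cover : (0 < n)%N ->
  \bigcup_(w in [set: 'S_(2 * n).+1]) Ecell R w = EL_ge0 R n.
Proof.
move=> n0; apply/seteqP; split=> x.
  move=> [w _ [s _]]; rewrite psi_image => -[a aP <-].
  by apply: uprod_EL_ge0 => //; apply: word_all.
move=> /EL_ge0_uprod[s [a [sN aP ->]]].
have [t tN xt] := uprod_staircase sN aP.
have tred := staircase_reduced tN; have [r rt] := word_surj tred.1.
exists (perm_word (2 * n) t) => //.
by rewrite (@Ecell_cell _ r) ?rt //; apply/reduced_wordP; rewrite rt.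
Qed.

Lemma Forall_nth (T : Type) (P : T -> Prop) (d : T) (r : seq T) k :
  List.Forall P r -> P d -> P (nth d r k).
Proof. by move=> rP Pd; elim: rP k => [|y r' yP _ IH] [|k] /=. Qed.

(** The parametrization by the staircase word of [w] has a continuous inverse,
    and the moves that connect this word to [s] carry the inverse over. *)
Lemma psi_homeomorphism (w : 'S_(2 * n).+1) (s : seq 'I_(2 * n)) :
  reduced_word w s ->
  homeomorphism_on (pos_orthant R (size s)) (Ecell R w) (psi R s).
Proof.
move=> sw; rewrite (Ecell_cell sw).
have [t [tN _ st]] := reduced_word_staircase sw.
have tall : all (fun i => (i < 2 * n)%N) t.
  by rewrite -(braid_eq_all _ st) word_all.
have [g gP] := recovers_braid_eq (braid_eq_sym st) tall
                 (staircase_recovers (leqnn _) tN).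
pose inv x := \row_(k < size s) nth 0 (eval g x) k.
have invK a : pos_orthant R (size s) a -> inv (psi R s a) = a.
  move=> aP; apply/rowP => k; rewrite mxE psiE gP.1 ?nth_entries //.
  exact: entries_params.
split.
- split.
  + by move=> a aP; rewrite /= -psi_image; exists a.
  + by move=> a b /set_mem aP /set_mem bP ab; rewrite -(invK _ aP) ab invK.
  + by rewrite -psi_image.
- apply/subspace_continuousP; rewrite -/(cont_on _ _).
  have -> : psi R s = (fun a : 'rV[R]_(size s) => uprod (word s)
      [seq h a | h <- [seq (fun b : 'rV[R]_(size s) => b 0 k)
                        | k <- enum 'I_(size s)]]).
    by apply/funext => a; rewrite psiE -map_comp.
  apply: cont_on_uprod; elim: (enum _) => [|k r IH] /=; first exact: List.Forall_nil.
  by apply: List.Forall_cons => //; apply: cont_on_coord; apply: cont_on_id.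
- exists inv => //; apply/subspace_continuousP; rewrite -/(cont_on _ _).
  apply: cont_on_mx => i k.
  have -> : (fun x => inv x i k) = nth (fun=> 0) g k.
    apply/funext => x; rewrite mxE /eval -[0 in LHS]/((fun=> 0) x).
    have gs := recovers_size gP; rewrite size_map in gs.
    by rewrite (nth_map (fun=> 0)) // gs.
  by apply: Forall_nth gP.2 _; apply: cont_on_cst.
Qed.

End Generators.

Theorem proposition4p2 (R : realType) (n : nat) (hn : (1 <= n)%N) :
  [/\ (forall (w : 'S_(2 * n).+1) (s : seq 'I_(2 * n)), reduced_word w s ->
         Ecell R w = psi R s @` pos_orthant R (size s)),
      trivIset [set: 'S_(2 * n).+1] (@Ecell R n),
      \bigcup_(w in [set: 'S_(2 * n).+1]) Ecell R w = EL_ge0 R n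
    & forall (w : 'S_(2 * n).+1) (s : seq 'I_(2 * n)), reduced_word w s ->
        homeomorphism_on (pos_orthant R (size s)) (Ecell R w) (psi R s)].
Proof.
split.
- by move=> w s sw; rewrite psi_image; apply: Ecell_cell.
- exact: Ecell_disjoint.
- exact: Ecell_cover.
- exact: psi_homeomorphism.
Qed.
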